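(* Any finite set of at least two distinct events of a path forms a chain. That is, any set of $n\ge 2$ distinct events of a path can be represented by the notation $a_1,a_2,\dots,a_n$ such that $(a_1,a_2,\dots,a_n)$ is a finite chain $[a_1\;a_2\;\dots\;a_n]$.
   Context: Let $\mathcal E$ be a set, whose elements are called events; let $\mathcal P$ be a set of subsets of $\mathcal E$, whose elements are called paths; and let $[\,\cdot\;\cdot\;\cdot\,]$ be a ternary relation (betweenness) on $\mathcal E$. Definitions. A finite chain $[q_0\;\dots\;q_n]$ is a sequence $(q_0,\dots,q_n)$ of events, $n\ge1$, such that: if $n=1$, then $q_0\ne q_1$ and some path contains both; if $n\ge2$, then $[q_i\;q_j\;q_k]$ for all $0\le i<j<k\le n$. An infinite chain is a sequence $(q_i)_{i\in\mathbb N}$ of events with $[q_i\;q_j\;q_k]$ for all $i<j<k$. A bound of an infinite chain is an event $q$ with $[q_i\;q_j\;q]$ for all $i<j$; a closest bound is a bound $q$ such that $[q_0\;q\;q']$ for every bound $q'\ne q$. For a path $Q$ and an event $b\notin Q$, the unreachable subset of $Q$ from $b$ is $Q(b,\emptyset)=\{x\in Q:\text{ no path contains both } b \text{ and } x\}$. For distinct paths $Q,R$ meeting at $x$ and $Q_a\in Q$, $Q(Q_a,R,x,\emptyset)=\{y: [x\;y\;Q_a]\text{ and there is } w\in R \text{ (}w\notin Q\text{) with } Q_a,y\in Q(w,\emptyset)\}$. $\mathrm{SPRAY}[x]$ is the set of paths containing the event $x$. Three distinct paths of $\mathrm{SPRAY}[x]$ are dependent if some path not in $\mathrm{SPRAY}[x]$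 meets each of the three; then each is said to be dependent on the set of the other two. Inductively, a path $T$ is dependent on a set $S\subseteq\mathrm{SPRAY}[x]$ with $n\ge3$ elements if $T$ is dependent on a set of two paths $\{S_1,S_2\}$, each of which is dependent on some subset of $S$ with $n-1$ elements. A set of paths is dependent if it contains a path $P$ and a subset not containing $P$ on which $P$ is dependent (for some $x$); it is independent if it has no dependent subset. $\mathrm{SPRAY}[x]$ is a 3-SPRAY if it contains four distinct paths forming an independent set such that every path of $\mathrm{SPRAY}[x]$ is dependent on the set of these four. The following axioms are assumed. (I1) $\mathcal E\neq\emptyset$. (I2) For distinct events $a,b$ there are paths $R\ni a$, $S\ni b$ with $R\cap S\ne\emptyset$. (I3) For any two distinct events there is at most one path containing both. (I4) If $\mathcal E\ne\emptyset$, there is at least one 3-SPRAY. (O1) If $[a\;b\;c]$ then some path contains $a,b,c$. (O2) $[a\;b\;c]\Rightarrow[c\;b\;a]$. (O3) $[a\;b\;c]\Rightarrow a\neq c$. (O4) $[a\;b\;c]$ and $[b\;c\;d]$ imply $[a\;b\;d]$ (no distinctness of $a,d$ is assumed). (O5) If $a,b,c$ are distinct events of one path, then $[a\;b\;c]$ or $[b\;c\;a]$ or $[c\;a\;b]$. (O6) If $Q,R,S$ are distinct paths, $T$ is a path, $a\in Q\cap R$, $b\in Q\cap S$, $c\in R\cap S$, and there are $d\in S$ with $[b\;c\;d]$ and $e\in R$ with $[c\;e\;a]$ and $d,e\in T$, then there is $f\in T\cap Q$ belonging to a finite chain with first event $a$ and last event $b$, where $a,f,b$ are distinct. (I5) For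 any path $Q$ and event $b\notin Q$, the set $Q(b,\emptyset)$ contains at least two events. (I6) For any path $Q$, event $b\notin Q$ and distinct $Q_x,Q_z\in Q(b,\emptyset)$ there is a finite chain $(q_0,\dots,q_n)$ with $q_0=Q_x$, $q_n=Q_z$ such that for all $i\in\{1,\dots,n\}$: $q_i\in Q(b,\emptyset)$, and every event $y$ with $[q_{i-1}\;y\;q_i]$ lies in $Q(b,\emptyset)$. (I7) For any path $Q$, event $b\notin Q$, $Q_x\in Q\setminus Q(b,\emptyset)$ and $Q_y\in Q(b,\emptyset)$ there is a finite chain $(q_0,\dots,q_n)$ and $0<m<n$ with $q_0=Q_x$, $q_m=Q_y$ and $q_n\in Q\setminus Q(b,\emptyset)$. (S) If $Q,R,S$ are distinct paths with $x\in Q\cap R\cap S$, and $Q_a\in Q\setminus\{x\}$ satisfies $Q(Q_a,R,x,\emptyset)=Q(Q_a,S,x,\emptyset)$, then there is a map $\theta:\mathcal E\to\mathcal E$ such that $P\mapsto\theta(P)$ (direct image) is a bijection $\mathcal P\to\mathcal P$, $\theta(y)=y$ for all $y\in Q$, and $\theta(R)=S$. (C) Every infinite chain that has a bound has a closest bound. *)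

(* Defs.v *)
From mathcomp Require Import all_boot boolp classical_sets functions cardinality.

Set Implicit Arguments.
Unset Strict Implicit.
Unset Printing Implicit Defensive.

Local Open Scope classical_set_scope.
Local Open Scope card_scope.

Section Spacetime.
Context (E : Type) (path : set (set E)) (btw : E -> E -> E -> Prop).

(* The chain [q_0 ... q_n], given by the values at 0, ..., n of a function on
   nat whose other values are irrelevant. *)
Definition finite_chain (n : nat) (q : nat -> E) : Prop :=
  [/\ (1 <= n)%N,
      n = 1%N ->
        q 0%N <> q 1%N /\ exists P, [/\ path P, P (q 0%N) & P (q 1%N)]
    & (2 <= n)%N ->
        forall i j k : nat, (i < j)%N -> (j < k)%N -> (k <= n)%N ->
          btw (q i) (q j) (q k)].

Definition infinite_chain (q : nat -> E) : Prop :=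
  forall i j k : nat, (i < j)%N -> (j < k)%N -> btw (q i) (q j) (q k).

Definition bound (q : nat -> E) (b : E) : Prop :=
  forall i j : nat, (i < j)%N -> btw (q i) (q j) b.

Definition closest_bound (q : nat -> E) (b : E) : Prop :=
  bound q b /\ forall b', bound q b' -> b' <> b -> btw (q 0%N) b b'.

(* Q(b, 0); only meaningful for a path Q and an event b outside Q. *)
Definition unreachable (Q : set E) (b : E) : set E :=
  [set x | Q x /\ ~ exists P, [/\ path P, P b & P x]].

(* Q(a, R, x, 0); only meaningful for distinct paths Q and R meeting at x, and
   a in Q. *)
Definition unreachable_via (Q : set E) (a : E) (R : set E) (x : E) : set E :=
  [set y | btw x y a /\
     exists w, [/\ R w, ~ Q w, unreachable Q w a & unreachable Q w y]].

Definition spray (x : E) : set (set E) := [set P | path P /\ P x].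

Definition dependent3 (x : E) (Q R S : set E) : Prop :=
  [/\ spray x Q, spray x R & spray x S] /\
  [/\ Q <> R, Q <> S & R <> S] /\
  exists P, [/\ path P, ~ spray x P &
    [/\ P `&` Q !=set0, P `&` R !=set0 & P `&` S !=set0]].

(* In the inductive step T is allowed to belong to S: in a 3-SPRAY, the four
   paths of the generating set must themselves depend on that set. *)
Inductive dependent_on (x : E) : set E -> set (set E) -> Prop :=
| dependent_on2 T S1 S2 :
    dependent3 x T S1 S2 -> dependent_on x T [set S1; S2]
| dependent_onS n T S S1 S2 U1 U2 :
    (3 <= n)%N -> S `<=` spray x -> S #= `I_n ->
    dependent3 x T S1 S2 ->
    U1 `<=` S -> U1 #= `I_n.-1 -> dependent_on x S1 U1 ->
    U2 `<=` S -> U2 #= `I_n.-1 -> dependent_on x S2 U2 ->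
    dependent_on x T S.

Definition dependent_set (D : set (set E)) : Prop :=
  exists x P U, [/\ D P, U `<=` D, ~ U P & dependent_on x P U].

Definition independent_set (D : set (set E)) : Prop :=
  forall D', D' `<=` D -> ~ dependent_set D'.

Definition three_spray (x : E) : Prop :=
  exists S : set (set E),
    [/\ S `<=` spray x, S #= `I_4, independent_set S
      & forall P, spray x P -> dependent_on x P S].

Record spacetime_axioms : Prop := SpacetimeAxioms {
  axI1 : [set: E] !=set0;
  axI2 : forall a b, a <> b ->
    exists R S, [/\ path R, path S, R a, S b & R `&` S !=set0];
  axI3 : forall a b P Q, a <> b -> path P -> path Q ->
    P a -> P b -> Q a -> Q b -> P = Q;
  axI4 : [set: E] !=set0 -> exists x, three_spray x;
  axO1 : forall a b c, btw a b c -> exists P, path P /\ [/\ P a, P b & P c];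
  axO2 : forall a b c, btw a b c -> btw c b a;
  axO3 : forall a b c, btw a b c -> a <> c;
  axO4 : forall a b c d, btw a b c -> btw b c d -> btw a b d;
  axO5 : forall Q a b c, path Q -> Q a -> Q b -> Q c ->
    a <> b -> b <> c -> a <> c -> [\/ btw a b c, btw b c a | btw c a b];
  axO6 : forall Q R S T a b c d e,
    path Q -> path R -> path S -> Q <> R -> Q <> S -> R <> S -> path T ->
    (Q `&` R) a -> (Q `&` S) b -> (R `&` S) c ->
    S d -> btw b c d -> R e -> btw c e a -> T d -> T e ->
    exists f, (T `&` Q) f /\ [/\ a <> f, f <> b & a <> b] /\
      exists n q, [/\ finite_chain n q, q 0%N = a, q n = b
        & exists2 i : nat, (i <= n)%N & q i = f];
  axI5 : forall Q b, path Q -> ~ Q b ->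
    exists x y, [/\ x <> y, unreachable Q b x & unreachable Q b y];
  axI6 : forall Q b Qx Qz, path Q -> ~ Q b ->
    unreachable Q b Qx -> unreachable Q b Qz -> Qx <> Qz ->
    exists n q, [/\ finite_chain n q, q 0%N = Qx, q n = Qz
      & forall i : nat, (1 <= i)%N -> (i <= n)%N ->
          unreachable Q b (q i) /\
          forall y, btw (q i.-1) y (q i) -> unreachable Q b y];
  axI7 : forall Q b Qx Qy, path Q -> ~ Q b ->
    (Q `\` unreachable Q b) Qx -> unreachable Q b Qy ->
    exists n m q, [/\ finite_chain n q, (0 < m < n)%N, q 0%N = Qx, q m = Qy
      & (Q `\` unreachable Q b) (q n)];
  axS : forall Q R S x Qa, path Q -> path R -> path S ->
    Q <> R -> Q <> S -> R <> S -> (Q `&` R `&` S) x -> Q Qa -> Qa <> x ->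
    unreachable_via Q Qa R x = unreachable_via Q Qa S x ->
    exists theta : E -> E,
      [/\ set_bij path path (fun P => theta @` P),
          forall y, Q y -> theta y = y
        & theta @` R = S];
  axC : forall q, infinite_chain q -> (exists b, bound q b) ->
    exists b, closest_bound q b
}.

End Spacetime.

(* Main.v *)
Require Import Defs.
From mathcomp Require Import all_boot boolp classical_sets functions cardinality.

Set Implicit Arguments.
Unset Strict Implicit.

Local Open Scope classical_set_scope.
Local Open Scope card_scope.

(** Four distinct events of a path whose triples are ordered by betweenness are,
    by (O2)-(O5) alone, either linearly ordered or form a "star": an event [b]
    lying between any two of the three others. A star is impossible: for a
    suitable event [e] outside the path, the rays from [b] contain events [a],
    [c], [d] joined to [e] by paths, and a path [T] through [b] meets the path
    [ae] beyond [a]. By (O6), [T] meets the sides [ce] and [de] of the triangle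
    [cde]; as it also meets [cd] at [b], it meets all three sides internally,
    which (O6) forbids. A finite set of events is then sorted by the distance
    from an event of the set that lies between no two others. *)

(** * Sorting a finite set by a strict order *)

Lemma maximal_element (T : Type) (lt : T -> T -> Prop)
    (ltxx : forall x, ~ lt x x)
    (lt_trans : forall x y z, lt x y -> lt y z -> lt x z) (n : nat) (X : set T) :
  X #= `I_n.+1 ->
  exists m, [/\ X m, X `\ m #= `I_n & forall y, X y -> ~ lt m y].
Proof.
elim: n X => [|n IHn] X /eq_cardSP[x Xx Xx'].
  exists x; split=> // y Xy ltxy.
  move: Xx'; rewrite II0 card_eq0 => /eqP Xx0.
  have [yx|yNx] := pselect (y = x); first by apply: (ltxx x); rewrite -{2}yx.
  by have : set0 y by rewrite -Xx0; split.
have [m [[Xm mx] Xm' maxm]] := IHn _ Xx'.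
have [ltmx|Nltmx] := pselect (lt m x).
  exists x; split=> // y Xy ltxy.
  have [yx|yNx] := pselect (y = x); first by apply: (ltxx x); rewrite -{2}yx.
  by apply: (maxm y); [split|exact: lt_trans ltxy].
exists m; split=> //.
  apply/eq_cardSP; exists x; first by split=> // xm; apply: mx.
  by rewrite setDDl setUC -setDDl.
move=> y Xy; have [->//|yNx] := pselect (y = x).
by apply: maxm; split.
Qed.

(** Induction on the size: a maximal element is placed last, after the sorted remainder. The element
    of [T] only provides values outside the relevant indices. *)
Lemma finite_sorting (T : Type) (lt : T -> T -> Prop)
    (ltxx : forall x, ~ lt x x)
    (lt_trans : forall x y z, lt x y -> lt y z -> lt x z) (n : nat) (X : set T)
    (lt_total : forall x y, X x -> X y -> x <> y -> lt x y \/ lt y x) :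
  T -> X #= `I_n ->
  exists a : nat -> T,
    X = a @` `I_n /\ forall i j, (i < j)%N -> (j < n)%N -> lt (a i) (a j).
Proof.
move=> t0; elim: n X lt_total => [|n IHn] X lt_total Xn.
  exists (fun=> t0); split=> //.
  by move: Xn; rewrite II0 image_set0 card_eq0 => /eqP.
have [m [Xm Xm' maxm]] := maximal_element ltxx lt_trans Xn.
have [|a [Xa a_lt]] := IHn _ _ Xm'.
  by move=> x y [Xx _] [Xy _]; exact: lt_total.
have aX i : (i < n)%N -> (X `\ m) (a i) by move=> ltin; rewrite Xa; exists i.
exists (fun i => if (i < n)%N then a i else m); split.
  apply/seteqP; split=> [x Xx|_ [i /= _ <-]]; last first.
    by case: ifP => // /aX[].
  have [->|xm] := pselect (x = m); first by exists n; rewrite //= ltnn.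
  have : (X `\ m) x by [].
  rewrite Xa => -[i /= ltin <-]; exists i; rewrite ?ltin //=.
  exact: ltn_trans ltin _.
move=> i j ltij; rewrite ltnS leq_eqVlt => /orP[/eqP jn|ltjn]; last first.
  by rewrite ltjn (ltn_trans ltij ltjn); exact: a_lt.
rewrite jn ltnn -jn ltij; have [|Xai ai_m] := aX i; first by rewrite -jn.
by case: (lt_total _ _ Xai Xm ai_m) => // /(maxm _ Xai).
Qed.

(** * Elementary properties of betweenness *)

Section Order.
Context (E : Type) (path : set (set E)) (btw : E -> E -> E -> Prop).
Context (ax : spacetime_axioms path btw).

Let O2 := axO2 ax.
Let O4 := axO4 ax.

Definition joined (x y : E) : Prop := exists P, [/\ path P, P x & P y].

Lemma joined_sym x y : joined x y -> joined y x.
Proof. by case=> P [pP Px Py]; exists P. Qed.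

Lemma btw_neq13 a b c : btw a b c -> a <> c.
Proof. exact: (axO3 ax). Qed.

Lemma btw_neq12 a b c : btw a b c -> a <> b.
Proof.
(* If [a = b], then [c a a] and [a a c] give [c a c] by (O4), against (O3). *)
by move=> abc ab; subst b; exact: btw_neq13 (O4 (O2 abc) abc) erefl.
Qed.

Lemma btw_neq23 a b c : btw a b c -> b <> c.
Proof. by move=> /O2 /btw_neq12 cb bc; exact: cb. Qed.

Lemma btw_asym a b c : btw a b c -> ~ btw b c a.
Proof. by move=> abc bca; exact: btw_neq13 (O4 abc bca) erefl. Qed.

Lemma path_eq a b P Q : a <> b -> path P -> path Q ->
  P a -> P b -> Q a -> Q b -> P = Q.
Proof. exact: (axI3 ax). Qed.

Lemma btw_path3 Q a b c : path Q -> btw a b c -> Q a -> Q b -> Q c.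
Proof.
move=> pQ abc Qa Qb; have [P [pP [Pa Pb Pc]]] := axO1 ax abc.
by rewrite (path_eq (btw_neq12 abc) pQ pP).
Qed.

Lemma btw_path2 Q a b c : path Q -> btw a b c -> Q a -> Q c -> Q b.
Proof.
move=> pQ abc Qa Qc; have [P [pP [Pa Pb Pc]]] := axO1 ax abc.
by rewrite (path_eq (btw_neq13 abc) pQ pP).
Qed.

(** * Pasch's property and transversals of a triangle *)

Lemma pasch Q R S T a b c d e :
  path Q -> path R -> path S -> path T -> Q <> R -> Q <> S -> R <> S ->
  Q a -> R a -> Q b -> S b -> R c -> S c ->
  btw b c d -> btw c e a -> T d -> T e ->
  exists f, [/\ T f, Q f & btw a f b].
Proof.
move=> pQ pR pS pT QR QS RS Qa Ra Qb Sb Rc Sc bcd cea Td Te.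
have Sd := btw_path3 pS bcd Sb Sc.
have Re := btw_path2 pR cea Rc Ra.
have [f [[Tf Qf] [[af fb ab] [n [q [[n1 _ ch] q0 qn [i ilen qi]]]]]]] :=
  axO6 ax pQ pR pS QR QS RS pT (conj Qa Ra) (conj Qb Sb) (conj Rc Sc)
    Sd bcd Re cea Td Te.
exists f; split=> //.
(* As [f] differs from both end events, its index in the chain is interior, which turns the chain of
   (O6) into [a f b]. *)
have i0 : (0 < i)%N by rewrite lt0n; apply/eqP => i0; apply: af; rewrite -qi i0.
have ltin : (i < n)%N.
  by rewrite ltn_neqAle ilen andbT; apply/eqP => i_n; apply: fb; rewrite -qi i_n.
by rewrite -q0 -qn -qi; apply: ch => //; exact: leq_ltn_trans i0 ltin.
Qed.

(** If [a' b' c'], apply [pasch] to the triangle [a' b c'] with sides on [P1], [P3], [T]: the path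
    [P2] passes through [b'] and, beyond [c'], through [a], so it meets [P1] between [a'] and [b].
    But [P1] and [P2] meet only at [c], which is not there. *)
Lemma transversal_ordered P1 P2 P3 T a b c a' b' c' :
  path P1 -> path P2 -> path P3 -> path T -> P1 <> P2 -> P1 <> P3 ->
  P1 b -> P1 c -> P2 c -> P2 a -> P3 a -> P3 b ->
  btw b a' c -> btw c b' a -> btw a c' b -> T a' -> T b' -> T c' ->
  ~ btw a' b' c'.
Proof.
move=> p1 p2 p3 pT P12 P13 P1b P1c P2c P2a P3a P3b ba'c cb'a ac'b Ta' Tb' Tc'.
have P1a' := btw_path2 p1 ba'c P1b P1c.
have P2b' := btw_path2 p2 cb'a P2c P2a.
have P3c' := btw_path2 p3 ac'b P3a P3b.
move=> a'b'c'.
have P1T : P1 <> T.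
  by move=> P1T; apply: P13; apply: (path_eq (btw_neq23 ac'b)) => //; rewrite P1T.
have TP3 : T <> P3.
  move=> TP3; apply: P13; apply: (path_eq (btw_neq12 ba'c)) => //.
  by rewrite -TP3.
have [f [P2f P1f a'fb]] := pasch p1 pT p3 p2 P1T P13 TP3 P1a' Ta' P1b P3b Tc' P3c'
  (O2 ac'b) (O2 a'b'c') P2a P2b'.
have [fc|fc] := pselect (f = c); last by apply: P12; exact: (path_eq fc).
by subst f; exact: btw_asym ba'c a'fb.
Qed.

(** By (O5) one of [a'], [b'], [c'] lies between the other two; cyclic symmetry of the triangle
    reduces to the ordered case. *)
Lemma no_internal_transversal P1 P2 P3 T a b c a' b' c' :
  path P1 -> path P2 -> path P3 -> path T -> P1 <> P2 -> P1 <> P3 -> P2 <> P3 ->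
  P1 b -> P1 c -> P2 c -> P2 a -> P3 a -> P3 b ->
  btw b a' c -> btw c b' a -> btw a c' b -> ~ [/\ T a', T b' & T c'].
Proof.
move=> p1 p2 p3 pT P12 P13 P23 P1b P1c P2c P2a P3a P3b ba'c cb'a ac'b
  [Ta' Tb' Tc'].
have P1a' := btw_path2 p1 ba'c P1b P1c.
have P2b' := btw_path2 p2 cb'a P2c P2a.
have P3c' := btw_path2 p3 ac'b P3a P3b.
have a'b' : a' <> b'.
  move=> eq; apply: P12; apply: (path_eq (btw_neq23 ba'c)) => //.
  by rewrite eq.
have b'c' : b' <> c'.
  move=> eq; apply: P23; apply: (path_eq (btw_neq23 cb'a)) => //.
  by rewrite eq.
have a'c' : a' <> c'.
  move=> eq; apply: P13; apply: (path_eq (btw_neq12 ba'c)) => //.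
  by rewrite eq.
case: (axO5 ax pT Ta' Tb' Tc' a'b' b'c' a'c').
- exact: (@transversal_ordered P1 P2 P3 T a b c).
- by apply: (@transversal_ordered P2 P3 P1 T b c a) => // /esym.
- by apply: (@transversal_ordered P3 P1 P2 T c a b) => // /esym.
Qed.

(** * Reachability, prolongation and existence of paths *)

Lemma exists_unreachable Q w : path Q -> ~ Q w -> exists y, Q y /\ ~ joined w y.
Proof. by move=> pQ Qw; have [y [_ [_ Uy _]]] := axI5 ax pQ Qw; exists y. Qed.

(** If [w] is not joined to [y], (I7) yields a chain from [x] through [y] to a reachable event. *)
Lemma joined_beyond Q w x y : path Q -> ~ Q w -> Q x -> Q y -> joined w x ->
  exists z, [/\ Q z, joined w z & z = y \/ btw x y z].
Proof.
move=> pQ Qw Qx Qy wx; have [wy|Nwy] := pselect (joined w y).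
  by exists y; split=> //; left.
have [||n [m [q [[n1 _ ch] /andP[m0 mn] <- <- [Qz Uz]]]]] :=
    axI7 ax (Qx := x) (Qy := y) pQ Qw.
- by split=> // -[].
- by split.
exists (q n); split=> //; first by apply: contrapT => Nz; exact: Uz.
by right; apply: ch => //; exact: leq_ltn_trans m0 mn.
Qed.

Lemma joined_elsewhere Q w x : path Q -> ~ Q w -> Q x -> joined w x ->
  exists z, [/\ Q z, joined w z & z <> x].
Proof.
move=> pQ Qw Qx wx; have [y [Qy Nwy]] := exists_unreachable pQ Qw.
have [z [Qz wz zy]] := joined_beyond pQ Qw Qx Qy wx.
exists z; split=> //; case: zy => [->|xyz zx]; first by move=> yx; rewrite yx in Nwy.
by apply: (btw_neq13 xyz).
Qed.

(** Some [w] on [R] is not joined to [y], by (I5), but is joined to [x] along [R]; so the event that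
    [joined_beyond] supplies cannot be [y] itself. *)
Lemma prolongation Q R x y : path Q -> path R -> Q <> R -> Q x -> Q y -> R x ->
  x <> y -> exists z, Q z /\ btw x y z.
Proof.
move=> pQ pR QR Qx Qy Rx xy.
have Ry : ~ R y by move=> Ry; apply: QR; exact: (path_eq xy).
have [w [Rw Nyw]] := exists_unreachable pR Ry.
have Qw : ~ Q w by move=> Qw; apply: Nyw; exists Q.
have wx : joined w x by exists R.
have [z [Qz wz [zy|xyz]]] := joined_beyond pQ Qw Qx Qy wx; last by exists z.
by case: Nyw; apply: joined_sym; rewrite -zy.
Qed.

(** (I4) provides a path [P] other than [Q], and (I5) two events on it, not both in [Q]. *)
Lemma exists_event_off Q a b : path Q -> Q a -> Q b -> a <> b -> exists w, ~ Q w.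
Proof.
move=> pQ Qa Qb ab; have [x [S [Sx S4 _ _]]] := axI4 ax (axI1 ax).
have [P [pP Px] PQ] : exists2 P, spray path x P & P <> Q.
  move: S4 => /eq_cardSP[P1 SP1 /eq_cardSP[P2 [SP2 P21] _]].
  have [P1Q|P1Q] := pselect (P1 = Q); last by exists P1 => //; exact: Sx.
  by exists P2; [exact: Sx|rewrite -P1Q].
have [u Pu] : exists u, ~ P u.
  have [Pa|Pa] := pselect (P a); last by exists a.
  by exists b => Pb; apply: PQ; exact: (path_eq ab).
have [y [z [yz [Py _] [Pz _]]]] := axI5 ax pP Pu.
have [Qy|Qy] := pselect (Q y); last by exists y.
by exists z => Qz; apply: PQ; exact: (path_eq yz).
Qed.

Lemma exists_other_path Q a b : path Q -> Q a -> Q b -> a <> b ->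
  exists S, [/\ path S, S a & S <> Q].
Proof.
move=> pQ Qa Qb ab; have [w Qw] := exists_event_off pQ Qa Qb ab.
have aw : a <> w by move=> aw; rewrite -aw in Qw.
have [R [S [pR pS Ra Sw [u [Ru Su]]]]] := axI2 ax aw.
have [RQ|RQ] := pselect (R = Q); last by exists R.
have SQ : S <> Q by move=> SQ; rewrite SQ in Sw.
have [Sa|Sa] := pselect (S a); first by exists S.
have au : joined a u by exists R.
(* Here [R = Q], so [S] meets [Q] only at [u]; a path from [a] to another event [z] of [S] therefore
   differs from [Q]. *)
have [z [Sz [P [pP Pa Pz]] zu]] := joined_elsewhere pS Sa Su au.
exists P; split=> // PQ; apply: SQ.
by apply: (path_eq zu) => //; [rewrite -PQ|rewrite -RQ].
Qed.

(** * Exclusion of stars and linear order on a path *)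

Lemma no_star a b c d : btw a b c -> btw a b d -> ~ btw c b d.
Proof.
move=> abc abd cbd; have [L [pL [La Lb Lc]]] := axO1 ax abc.
have Ld := btw_path3 pL abd La Lb.
have ab := btw_neq12 abc.
have [S [pS Sa SL]] := exists_other_path pL La Lb ab.
have S_L y : L y -> y <> a -> ~ S y.
  by move=> Ly ya Sy; apply: SL; exact: (path_eq ya).
have Sb : ~ S b by apply: S_L => // ba; exact: ab.
have ba : joined b a by exists L.
have [e [Se be ea]] := joined_elsewhere pS Sb Sa ba.
have Le : ~ L e by move=> Le; apply: SL; exact: (path_eq ea).
(* The transversal [T] runs from [b] to an event of [S] beyond [a] as seen from [e]. *)
have [z [Sz [T [pT Tb Tz]] eaz]] : exists z, [/\ S z, joined b z & btw e a z].
  have [P [pP Pb Pe]] := be.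
  have SP : S <> P by move=> SP; rewrite SP in Sb.
  have [t [St eat]] := prolongation pS pP SP Se Sa Pe ea.
  have [z [Sz bz [zt|atz]]] := joined_beyond pS Sb Sa St ba.
    by exists z; split=> //; rewrite zt.
  by exists z; split=> //; exact: O4 atz.
have eb := joined_sym be.
(* Moving outwards on their rays from [b], [c] and [d] are replaced by events joined to [e]; (O4)
   preserves the star. *)
have extend p q : L p -> btw a b p -> btw q b p ->
    exists p', [/\ L p', joined e p', btw a b p' & btw q b p'].
  move=> Lp abp qbp.
  have [p' [Lp' ep' bpp']] := joined_beyond pL Le Lb Lp eb.
  exists p'; case: bpp' => [p'p|bpp']; first by rewrite p'p in ep' *; split.
  by split=> //; exact: O4 bpp'.
have [c' [Lc' [Q [pQ Qe Qc']] abc' dbc']] := extend c d Lc abc (O2 cbd).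
have [d' [Ld' [R [pR Re Rd']] abd' c'bd']] := extend d c' Ld abd (O2 dbc').
(* In the triangle [x a e], [T] meets side [ax] at [b] and [ea] beyond [a] at [z], so it meets side
   [xe] internally. *)
have hits x P : L x -> path P -> P e -> P x -> btw a b x ->
    exists f, T f /\ btw x f e.
  move=> Lx pP Pe Px abx.
  have PL : P <> L by move=> PL; rewrite PL in Pe.
  have PS : P <> S.
    by move=> PS; apply: (S_L x Lx (fun xa => btw_neq13 abx (esym xa))); rewrite -PS.
  have [f [Tf _ xfe]] := pasch pP pL pS pT PL PS (fun LS => SL (esym LS))
    Px Lx Pe Se La Sa eaz abx Tz Tb.
  by exists f.
have [f [Tf c'fe]] := hits _ _ Lc' pQ Qe Qc' abc'.
have [g [Tg d'ge]] := hits _ _ Ld' pR Re Rd' abd'.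
have QL : Q <> L by move=> QL; rewrite QL in Qe.
have RL : R <> L by move=> RL; rewrite RL in Re.
have QR : Q <> R.
  move=> QR; apply: QL; apply: (path_eq (btw_neq13 c'bd')) => //.
  by rewrite QR.
exact: (no_internal_transversal pL pR pQ pT (fun e => RL (esym e))
  (fun e => QL (esym e)) (fun e => QR (esym e)) Lc' Ld' Rd' Re Qe Qc'
  c'bd' d'ge (O2 c'fe) (And3 Tb Tg Tf)).
Qed.

Lemma btw_inner_trans Q a x y z : path Q -> Q a -> Q x -> Q y -> Q z ->
  btw a x y -> btw a y z -> btw a x z /\ btw x y z.
Proof.
move=> pQ Qa Qx Qy Qz axy ayz.
have xz : x <> z.
  by move=> xz; subst z; exact: btw_asym axy (O2 ayz).
have yNzx : ~ btw y z x by move=> /(O4 ayz) /O2; exact: btw_asym axy.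
have axz : btw a x z.
  case: (axO5 ax pQ Qx Qy Qz (btw_neq23 axy) (btw_neq23 ayz) xz) => //.
    exact: O4.
  move=> zxy.
  case: (axO5 ax pQ Qa Qx Qz (btw_neq12 axy) xz (btw_neq13 ayz)) => //.
    by move=> xza; case: (btw_asym (O4 (O2 xza) zxy)); exact: O2.
  by move=> zax; case: (btw_asym (O4 zax axy)).
split=> //.
case: (axO5 ax pQ Qx Qy Qz (btw_neq23 axy) (btw_neq23 ayz) xz) => //.
(* The remaining order [z x y] would make [x] the centre of a star on [a], [y], [z]. *)
by move=> /O2 /(no_star axy axz).
Qed.

(** Since [a] separates [y] from [z], it separates [o] from at least one of them. *)
Lemma btw_split Q y a z o : path Q -> Q y -> Q a -> Q z -> Q o ->
  btw y a z -> o <> y -> o <> a -> o <> z -> btw o a z \/ btw o a y.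
Proof.
move=> pQ Qy Qa Qz Qo yaz oy oa oz.
case: (axO5 ax pQ Qo Qa Qz oa (btw_neq23 yaz) oz); first by left.
  by move=> /(O4 yaz) /O2; right.
move=> zoa.
have [_ oay] := btw_inner_trans pQ Qz Qo Qa Qy zoa (O2 yaz).
by right.
Qed.

End Order.

(** * Ordering the events from an end event *)

Theorem theorem10 (E : Type) (path : set (set E)) (btw : E -> E -> E -> Prop)
    (ax : spacetime_axioms path btw)
    (Q : set E) (hQ : path Q) (n : nat) (hn : (2 <= n)%N)
    (X : set E) (hXQ : X `<=` Q) (hX : X #= `I_n) :
  exists a : nat -> E, finite_chain path btw n.-1 a /\ X = a @` `I_n.
Proof.
have [m nm] : exists m, n = m.+2 by case: n hn {hX} => [|[|m]] // _; exists m.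
subst n; have [o Xo Xo'] := elimT (eq_cardSP _ _) hX.
pose from x y z := [/\ Q x, Q y, Q z & btw x y z].
have fromxx x y : ~ from x y y.
  by case=> _ _ _ xyy; exact: (btw_neq23 ax xyy).
have from_inner x y z t : from x y z -> from x z t -> from x y t /\ btw y z t.
  move=> [Qx Qy Qz xyz] [_ _ Qt xzt].
  by have [] := btw_inner_trans ax hQ Qx Qy Qz Qt xyz xzt.
have from_trans x y z t : from x y z -> from x z t -> from x y t.
  by move=> xyz xzt; have [] := from_inner x y z t xyz xzt.
(* An event [a] farthest from an arbitrary [o] on its side is an end event: were it between two
   events of [X], [btw_split] would give one beyond [a] from [o]. *)
have [a [[Xa ao] _ a_far]] :=
  maximal_element (fromxx o) (fun x y z => from_trans o x y z) Xo'.
have a_end y z : X y -> X z -> ~ btw y a z.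
  move=> Xy Xz yaz.
  have far x : X x -> ~ btw o a x.
    move=> Xx oax; have xo : x <> o by move=> xo; exact: (axO3 ax oax).
    by apply: (a_far x) => //; split=> //; exact: hXQ.
  have [oy|oy] := pselect (o = y); first by apply: (far z) => //; rewrite oy.
  have [oz|oz] := pselect (o = z).
    by apply: (far y) => //; apply: (axO2 ax); rewrite oz.
  have [oaz|oay] := btw_split ax hQ (hXQ _ Xy) (hXQ _ Xa) (hXQ _ Xz)
    (hXQ _ Xo) yaz oy (fun e => ao (esym e)) oz; [exact: far oaz|exact: far oay].
(* The first alternative makes [a] the least event, since [from a a y] never holds. *)
pose lt x y := (x = a /\ y <> a) \/ from a x y.
have ltxx x : ~ lt x x by move=> [[]//|]; exact: fromxx.
have lt_from x y z : lt x y -> lt y z -> from a y z.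
  move=> lxy [[ya _]|//]; case: lxy => [[_]//|[_ _ _ /(axO3 ax)]].
  by rewrite ya.
have lt_trans x y z : lt x y -> lt y z -> lt x z.
  move=> lxy lyz; have ayz := lt_from x y z lxy lyz.
  case: lxy => [[xa _]|axy]; last by right; exact: from_trans ayz.
  by left; split=> // za; case: ayz => _ _ _ /(axO3 ax); rewrite za.
have lt_total x y : X x -> X y -> x <> y -> lt x y \/ lt y x.
  move=> Xx Xy xy.
  have [xa|xa] := pselect (x = a).
    by left; left; split=> //; rewrite -xa => /esym.
  have [ya|ya] := pselect (y = a); first by right; left.
  have Qx := hXQ _ Xx; have Qy := hXQ _ Xy; have Qa := hXQ _ Xa.
  case: (axO5 ax hQ Qa Qx Qy (fun e => xa (esym e)) xy (fun e => ya (esym e))).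
  - by left; right.
  - by move=> /(axO2 ax) ayx; right; right; split.
  - by move=> yax; case: (a_end y x).
have [f [Xf f_lt]] := finite_sorting ltxx lt_trans lt_total a hX.
have Qf i : (i < m.+2)%N -> Q (f i).
  by move=> im; apply: hXQ; rewrite Xf; exists i.
exists f; split=> //; split=> //= [m0|_ i j k ij jk km].
  have f01 := f_lt 0 1 isT isT; split.
    by move=> f01E; apply: (ltxx (f 0)); rewrite {2}f01E.
  by exists Q; split=> //; exact: Qf.
have lij : lt (f i) (f j) by apply: f_lt => //; exact: ltn_trans jk _.
have ajk := lt_from _ _ _ lij (f_lt _ _ jk km).
(* Either [f i] is [a] itself, or [a f(i) f(j)] and [a f(j) f(k)] give [f(i) f(j) f(k)]. *)
case: lij => [[-> _]|aij]; first by case: ajk.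
by have [] := from_inner _ _ _ _ aij ajk.
Qed.
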